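(* Let $A$ be an affine cellular $k$-algebra with cell chain $0=J_0\subset J_1\subset\cdots\subset J_n=A$, decomposition $A=J_1'\oplus\cdots\oplus J_n'$ and cell data $(B_i,\sigma_i,\Delta_i,\psi^{(i)},\alpha_i)$, $d_i=\mathrm{rank}_{B_i}(\Delta_i)$, such that no determinant $\det(\psi^{(i)})$ ($1\le i\le n$) is a zero-divisor in $B_i$. For $1\le i\le n$ put $e_i=\alpha_i^{-1}(\mathbf I_{d_i})\in J_i/J_{i-1}$, where $\mathbf I_{d_i}$ is the identity matrix, and let $\Theta_i:A\to M_{d_i}(B_i)$, $\Theta_i(a)=\alpha_i(ae_i)$. Then $\Theta=(\Theta_n,\ldots,\Theta_1):A\to\widehat A=M_{d_n}(B_n)\times\cdots\times M_{d_1}(B_1)$ is an embedding of $A$ into its asymptotic algebra. More concretely, $$\Theta(a)=(\alpha_n(ae_n),\ldots,\alpha_1(ae_1)),\qquad a\in A.$$ Let $1\le k\le n$. Then for any $a\in J_k'$, with $\overline a=a+J_{k-1}$, $$\Theta(a)=(\alpha_n(ae_n),\ldots,\alpha_{k+1}(ae_{k+1}),\ \alpha_k(\overline a)\psi^{(k)},\ 0,\ldots,0),$$ since $\Theta_l(a)=0$ for all $l<k$; here $\alpha_k(\overline a)\psi^{(k)}$ (ordinary matrix product) is the component in $M_{d_k}(B_k)$.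
   Context: Conventions. $k$ is a commutative Noetherian domain. A $k$-involution is a $k$-linear anti-automorphism whose square is the identity. An affine commutative $k$-algebra is a finitely generated commutative unital $k$-algebra. The element $0$ counts as a zero-divisor. Affine cell ideal. Let $A$ be a unital $k$-algebra with a $k$-involution $i$. A two-sided ideal $J$ with $i(J)=J$ is an affine cell ideal if (1) there are a free $k$-module $V$ of finite rank $d$ and an affine commutative $k$-algebra $B$ with $k$-involution $\sigma$ such that $\Delta:=V\otimes_kB$ is an $A$-$B$-bimodule whose right $B$-structure is induced by the regular module $B_B$; (2) there is an $A$-$A$-bimodule isomorphism $\alpha:J\to\Delta\otimes_B\Delta'$, where $\Delta'=B\otimes_kV$ is a $B$-$A$-bimodule with left $B$-structure induced by ${}_BB$ and right $A$-structure $(b\otimes v)a:=\tau(i(a)(v\otimes b))$, $\tau$ the flip, such that, identifying $\Delta\otimes_B\Delta'$ with $V\otimes_kB\otimes_kV$, $\alpha(i(\alpha^{-1}(u\otimes b\otimes v)))=v\otimes\sigma(b)\otimes u$. $\Delta$ is the cell module of $J$. There is a $k$-bilinear $\psi:V\times V\to B$ with $\alpha(\alpha^{-1}(u\otimes b\otimes v)\,\alpha^{-1}(u'\otimes b'\otimes v'))=u\otimes b\psi(v,u')b'\otimes v'$. Fix a basis $v_1,\dots,v_d$ of $V$; the swich matrix is $\psi=(\psi(v_r,v_s))_{r,s}\in M_d(B)$. Identifying $v_r\otimes b\otimes v_s$ with $bE_{rs}$ ($E_{rs}$ the matrix units), $\alpha$ becomes a bijection $J\to M_d(B)$ with $\alpha(xy)=\alpha(x)\psi\alpha(y)$.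 $(B,\sigma,\Delta,\psi,\alpha)$ is the cell datum of $J$. Affine cellular algebra. $A$ (with $i$) is affine cellular if $A=J_1'\oplus\cdots\oplus J_n'$ as $k$-modules with $i(J_j')=J_j'$, such that the $J_j=\bigoplus_{l\le j}J_l'$ form a chain of two-sided ideals $0=J_0\subset J_1\subset\cdots\subset J_n=A$ (cell chain) and each $J_j/J_{j-1}$ is an affine cell ideal of $A/J_{j-1}$ (for the induced involution), with cell datum $(B_j,\sigma_j,\Delta_j,\psi^{(j)},\alpha_j)$. Each $J_j/J_{j-1}$ is an $A$-bimodule, and $ae_j$ denotes the left action of $a\in A$ on $e_j\in J_j/J_{j-1}$. The asymptotic algebra is the ring $\widehat A=M_{d_n}(B_n)\times\cdots\times M_{d_1}(B_1)$ with ordinary matrix multiplication, $d_j=\mathrm{rank}_{B_j}(\Delta_j)$.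
   Formalization: The claim Θ_l(a)=0 for l<k, a∈J_k', is false (A=Q×Q, J_1'=Q(1,0), J_2'=Q(1,1), a=(1,1)); the formal theorem proves Θ_l(a)=0 for l>k instead, with Θ_l(a)=α_l(ae_l) for l<k and α_k(ā)ψ^(k) at l=k. *)

(* Defs.v *)
From HB Require Import structures.
From mathcomp Require Import all_boot all_order all_algebra generic_quotient.
From mathcomp Require Import boolp classical_sets.

Set Implicit Arguments.
Unset Strict Implicit.
Unset Printing Implicit Defensive.

Import GRing.Theory.

Local Open Scope classical_set_scope.
Local Open Scope ring_scope.
Local Open Scope quotient_scope.

Definition zero_divisor (R : comNzRingType) (x : R) : Prop :=
  x = 0 \/ exists y : R, y <> 0 /\ x * y = 0.

Definition noetherian (R : comNzRingType) : Prop :=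
  forall I : set R, I 0 -> (forall a x y, I x -> I y -> I (a * x + y)) ->
    exists s : seq R,
      I = [set x | exists c : 'I_(size s) -> R,
                     x = \sum_(r < size s) c r * s`_r].

Definition k_involution (k : comNzRingType) (A : algType k) (i : A -> A) :
    Prop :=
  [/\ linear i, forall x y, i (x * y) = i y * i x & involutive i].

(* Finitely generated: some finite set lies in no subalgebra but [B]. *)
Definition affine_algebra (k : comNzRingType) (B : comAlgType k) : Prop :=
  exists s : seq B, forall S : set B, S 1 ->
    (forall (c : k) x y, S x -> S y -> S (c *: x + y)) ->
    (forall x y, S x -> S y -> S (x * y)) ->
    (forall x, x \in s -> S x) -> S = setT.

Definition two_sided_ideal (A : nzRingType) (J : set A) : Prop :=
  [/\ J 0, forall x y, J x -> J y -> J (x - y),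
      forall a x, J x -> J (a * x) & forall a x, J x -> J (x * a)].

Definition proper_two_sided_ideal (A : nzRingType) (J : set A) : Prop :=
  two_sided_ideal J /\ ~ J 1.

(* The quotient algebra [A / J]; MathComp only has quotients of commutative
   rings. As an [algType] is nonzero, [J] has to be proper. *)
Section Quotient.
Variables (k : comNzRingType) (A : algType k) (J : set A).
Hypothesis idJ : proper_two_sided_ideal J.

Let J0 : J 0. Proof. by case: idJ => -[]. Qed.
Let JB x y : J x -> J y -> J (x - y). Proof. by case: idJ => -[_ + _ _] _; apply. Qed.
Let JMl a x : J x -> J (a * x). Proof. by case: idJ => -[_ _ + _] _; apply. Qed.
Let JMr a x : J x -> J (x * a). Proof. by case: idJ => -[_ _ _ +] _; apply. Qed.
Let JN x : J x -> J (- x). Proof. by move=> Jx; rewrite -sub0r; apply: JB. Qed.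
Let JD x y : J x -> J y -> J (x + y).
Proof. by move=> Jx Jy; rewrite -[y]opprK; apply: JB => //; apply: JN. Qed.
Let JZ (c : k) x : J x -> J (c *: x).
Proof. by move=> Jx; rewrite -[x]mul1r scalerAl; apply: JMl. Qed.

Definition qequiv (x y : A) : bool := `[< J (x - y) >].

Lemma qequiv_is_equiv : equiv_class_of qequiv.
Proof.
split=> [x|x y|y x z].
- by apply/asboolP; rewrite subrr.
- by apply/asboolP/asboolP => /JN; rewrite opprB.
- move=> /asboolP h1 /asboolP h2; apply/asboolP.
  by rewrite -[x](addrNK y) -addrA; apply: JD.
Qed.

Canonical qequiv_equiv := EquivRelPack qequiv_is_equiv.
Canonical qequiv_encModRel := defaultEncModRel qequiv.

Definition quot := {eq_quot qequiv}.

HB.instance Definition _ : EqQuotient A qequiv quot := EqQuotient.on quot.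
HB.instance Definition _ := Choice.on quot.

Definition qpi (x : A) : quot := \pi_quot x.

Lemma qpiE x y : qpi x = qpi y <-> J (x - y).
Proof.
split=> [/eqP|h]; first by rewrite /qpi piE => /asboolP.
by apply/eqP; rewrite /qpi piE; apply/asboolP.
Qed.

Lemma qreprK (x : quot) : qpi (repr x) = x.
Proof. exact: reprK. Qed.

Lemma qpi_repr x : J (repr (qpi x) - x).
Proof. by apply/qpiE; rewrite qreprK. Qed.

Definition qadd (x y : quot) : quot := qpi (repr x + repr y).
Definition qopp (x : quot) : quot := qpi (- repr x).
Definition qmul (x y : quot) : quot := qpi (repr x * repr y).
Definition qscale (c : k) (x : quot) : quot := qpi (c *: repr x).

Lemma qaddE x y : qadd (qpi x) (qpi y) = qpi (x + y).
Proof. by apply/qpiE; rewrite opprD addrACA; apply: JD; apply: qpi_repr. Qed.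

Lemma qoppE x : qopp (qpi x) = qpi (- x).
Proof. by apply/qpiE; rewrite -opprD; apply/JN/qpi_repr. Qed.

Lemma qmulE x y : qmul (qpi x) (qpi y) = qpi (x * y).
Proof.
apply/qpiE; set x' := repr _; set y' := repr _.
have -> : x' * y' - x * y = (x' - x) * y' + x * (y' - y).
  by rewrite mulrBl mulrBr addrA addrNK.
by apply: JD; [apply: JMr | apply: JMl]; apply: qpi_repr.
Qed.

Lemma qscaleE c x : qscale c (qpi x) = qpi (c *: x).
Proof. by apply/qpiE; rewrite -scalerBr; apply/JZ/qpi_repr. Qed.

Let qE := (qaddE, qoppE, qmulE, qscaleE).

Fact qaddA : associative qadd.
Proof. by move=> x y z; rewrite -[x]qreprK -[y]qreprK -[z]qreprK !qE addrA. Qed.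
Fact qaddC : commutative qadd.
Proof. by move=> x y; rewrite -[x]qreprK -[y]qreprK !qE addrC. Qed.
Fact qadd0 : left_id (qpi 0) qadd.
Proof. by move=> x; rewrite -[x]qreprK !qE add0r. Qed.
Fact qaddN : left_inverse (qpi 0) qopp qadd.
Proof. by move=> x; rewrite -[x]qreprK !qE addNr. Qed.

HB.instance Definition _ :=
  GRing.isZmodule.Build quot qaddA qaddC qadd0 qaddN.

Fact qmulA : associative qmul.
Proof. by move=> x y z; rewrite -[x]qreprK -[y]qreprK -[z]qreprK !qE mulrA. Qed.
Fact qmul1l : left_id (qpi 1) qmul.
Proof. by move=> x; rewrite -[x]qreprK !qE mul1r. Qed.
Fact qmul1r : right_id (qpi 1) qmul.
Proof. by move=> x; rewrite -[x]qreprK !qE mulr1. Qed.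
Fact qmulDl : left_distributive qmul qadd.
Proof. by move=> x y z; rewrite -[x]qreprK -[y]qreprK -[z]qreprK !qE mulrDl. Qed.
Fact qmulDr : right_distributive qmul qadd.
Proof. by move=> x y z; rewrite -[x]qreprK -[y]qreprK -[z]qreprK !qE mulrDr. Qed.
Fact qoner_neq0 : qpi 1 != qpi 0.
Proof. by apply/eqP => /qpiE; rewrite subr0; case: idJ. Qed.

HB.instance Definition _ := GRing.Zmodule_isNzRing.Build quot
  qmulA qmul1l qmul1r qmulDl qmulDr qoner_neq0.

Fact qscaleA c d x : qscale c (qscale d x) = qscale (c * d) x.
Proof. by rewrite -[x]qreprK !qE scalerA. Qed.
Fact qscale1 : left_id 1 qscale.
Proof. by move=> x; rewrite -[x]qreprK !qE scale1r. Qed.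
Fact qscaleDr : right_distributive qscale +%R.
Proof.
by move=> c x y; rewrite -[x]qreprK -[y]qreprK /GRing.add /= !qE scalerDr.
Qed.
Fact qscaleDl x : {morph qscale^~ x : c d / c + d >-> c + d}.
Proof. by move=> c d; rewrite -[x]qreprK [RHS]/GRing.add /= !qE scalerDl. Qed.

HB.instance Definition _ := GRing.Zmodule_isLmodule.Build k quot
  qscaleA qscale1 qscaleDr qscaleDl.

Fact qscaleAl (c : k) (x y : quot) : c *: (x * y) = c *: x * y.
Proof.
rewrite -[x]qreprK -[y]qreprK /GRing.scale /GRing.mul /= !qE.
by rewrite scalerAl.
Qed.
HB.instance Definition _ := GRing.Lmodule_isLalgebra.Build k quot qscaleAl.

Fact qscaleAr (c : k) (x y : quot) : c *: (x * y) = x * (c *: y).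
Proof.
rewrite -[x]qreprK -[y]qreprK /GRing.scale /GRing.mul /= !qE.
by rewrite scalerAr.
Qed.
HB.instance Definition _ := GRing.Lalgebra_isAlgebra.Build k quot qscaleAr.

(* The map induced by [f] on the quotient, meaningful when [f] is additive and
   preserves [J]. *)
Definition qmap (f : A -> A) (x : quot) : quot := qpi (f (repr x)).

Lemma qmapE (f : A -> A) x :
  zmod_morphism f -> (forall y, J y -> J (f y)) -> qmap f (qpi x) = qpi (f x).
Proof. by move=> fB fJ; apply/qpiE; rewrite -fB; apply/fJ/qpi_repr. Qed.

End Quotient.

(* [V] is [k^d] with its standard basis, so that
   [V (x)_k B], [B (x)_k V] and [V (x)_k B (x)_k V] are the columns, rows and
   square matrices over [B]. Then [(u (x) b) (x)_B (b' (x) v)] is the product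
   of a column by a row, and both flips are transposition. The right action of
   the commutative ring [B] on columns is written as scaling. *)
Definition tensor3 (k : comNzRingType) (B : comAlgType k) (d : nat)
    (u : 'cV[k]_d) (b : B) (v : 'cV[k]_d) : 'M[B]_d :=
  \matrix_(r, s) ((u r 0 * v s 0) *: b).

Record cell_datum (k : comNzRingType) (A : algType k) (i : A -> A)
    (J : set A) := CellDatum {
  cell_ring : comAlgType k;
  cell_sigma : cell_ring -> cell_ring;
  cell_rank : nat;
  (* the [A]-action on [Delta]; linearity is right [B]-linearity *)
  cell_act : A -> {linear 'cV[cell_ring]_cell_rank ->
                          'cV[cell_ring]_cell_rank};
  (* [alpha], whose values outside [J] are irrelevant, and its inverse *)
  cell_alpha : A -> 'M[cell_ring]_cell_rank;
  cell_alphaV : 'M[cell_ring]_cell_rank -> A;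
  cell_psi : 'cV[k]_cell_rank -> 'cV[k]_cell_rank -> cell_ring;

  cell_ideal : two_sided_ideal J;
  cell_ideal_inv : i @` J = J;

  cell_ring_affine : affine_algebra cell_ring;
  cell_sigma_inv : k_involution cell_sigma;

  cell_act1 : forall x, cell_act 1 x = x;
  cell_actM : forall a a' x, cell_act (a * a') x = cell_act a (cell_act a' x);
  cell_actD : forall a a' x, cell_act (a + a') x = cell_act a x + cell_act a' x;
  cell_actZ : forall (c : k) a x, cell_act (c *: a) x = c%:A *: cell_act a x;

  cell_alphaV_in : forall M, J (cell_alphaV M);
  cell_alphaVK : forall M, cell_alpha (cell_alphaV M) = M;
  cell_alphaK : forall x, J x -> cell_alphaV (cell_alpha x) = x;
  cell_alphaD : forall x y, J x -> J y ->
    cell_alpha (x + y) = cell_alpha x + cell_alpha y;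
  cell_alpha_left : forall a (x : 'cV_cell_rank) (y : 'rV_cell_rank),
    cell_alpha (a * cell_alphaV (x *m y)) = cell_act a x *m y;
  cell_alpha_right : forall a (x : 'cV_cell_rank) (y : 'rV_cell_rank),
    cell_alpha (cell_alphaV (x *m y) * a) = x *m (cell_act (i a) y^T)^T;
  cell_alpha_inv : forall u b v,
    cell_alpha (i (cell_alphaV (tensor3 u b v)))
      = tensor3 v (cell_sigma b) u;

  cell_psi_linearl : forall (c : k) u u' v,
    cell_psi (c *: u + u') v = c *: cell_psi u v + cell_psi u' v;
  cell_psi_linearr : forall (c : k) u v v',
    cell_psi u (c *: v + v') = c *: cell_psi u v + cell_psi u v';
  cell_psiE : forall u b v u' b' v',
    cell_alpha (cell_alphaV (tensor3 u b v) * cell_alphaV (tensor3 u' b' v'))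
      = tensor3 u (b * cell_psi v u' * b') v'
}.

Arguments cell_sigma {k A i J} D _ : rename.
Arguments cell_act {k A i J} D _ : rename.
Arguments cell_alpha {k A i J} D _ : rename.
Arguments cell_alphaV {k A i J} D _ : rename.
Arguments cell_psi {k A i J} D _ _ : rename.

Definition swich (k : comNzRingType) (A : algType k) (i : A -> A) (J : set A)
    (D : cell_datum i J) : 'M[cell_ring D]_(cell_rank D) :=
  \matrix_(r, s) cell_psi D (delta_mx r 0) (delta_mx s 0).

(* Layers are numbered from 0: [J' j] is the (j+1)-st summand, and [chain J' m]
   is the sum of the first [m] summands. *)
Definition chain (k : comNzRingType) (A : algType k) (n : nat)
    (J' : 'I_n -> set A) (m : nat) : set A :=
  [set x | exists f : 'I_n -> A,
     (forall l, J' l (f l)) /\ x = \sum_(l < n | (l < m)%N) f l].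

(* That [chain J' 0] is 0 and [chain J' n] is [A] follows from the direct sum
   decomposition. For [j < n], [chain J' j] is proper as soon as the inclusions
   of the chain are strict. *)
Record affine_cellular (k : comNzRingType) (A : algType k) (i : A -> A) :=
  AffineCellular {
  ac_len : nat;
  ac_layer : 'I_ac_len -> set A;
  ac_layer0 : forall j, ac_layer j 0;
  ac_layer_linear : forall j (c : k) x y,
    ac_layer j x -> ac_layer j y -> ac_layer j (c *: x + y);
  ac_layer_inv : forall j, i @` ac_layer j = ac_layer j;
  ac_layer_span : forall a : A, exists f : 'I_ac_len -> A,
    (forall j, ac_layer j (f j)) /\ a = \sum_(j < ac_len) f j;
  ac_layer_direct : forall f : 'I_ac_len -> A,
    (forall j, ac_layer j (f j)) -> \sum_(j < ac_len) f j = 0 ->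
    forall j, f j = 0;
  ac_chain : forall j : 'I_ac_len, proper_two_sided_ideal (chain ac_layer j);
  ac_cell : forall j : 'I_ac_len,
    @cell_datum k (quot (ac_chain j)) (qmap i)
      (@qpi k A _ (ac_chain j) @` chain ac_layer j.+1)
}.

Arguments ac_layer {k A i} C _ _ : rename.
Arguments ac_chain {k A i} C j : rename.
Arguments ac_cell {k A i} C j : rename.

(* The scalars of [k] act on [M_(d j)(B j)] through [k -> B j]. *)
Section MatrixProduct.
Variables (k : comNzRingType) (n : nat).
Variables (B : 'I_n -> comAlgType k) (d : 'I_n -> nat).

Definition mxprod : Type := {dffun forall j : 'I_n, 'M[B j]_(d j)}.
HB.instance Definition _ := Choice.on mxprod.

Implicit Types f g h : mxprod.

Definition mxprod_zero : mxprod := [ffun j => 0 : 'M[B j]_(d j)].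
Definition mxprod_opp f : mxprod := [ffun j => - f j : 'M[B j]_(d j)].
Definition mxprod_add f g : mxprod := [ffun j => f j + g j : 'M[B j]_(d j)].
Definition mxprod_one : mxprod := [ffun j => 1%:M : 'M[B j]_(d j)].
Definition mxprod_mul f g : mxprod := [ffun j => f j *m g j : 'M[B j]_(d j)].
Definition mxprod_scale (c : k) f : mxprod :=
  [ffun j => (c%:A : B j) *: f j : 'M[B j]_(d j)].

Fact mxprod_addA : associative mxprod_add.
Proof. by move=> f g h; apply/ffunP => j; rewrite !ffunE addrA. Qed.
Fact mxprod_addC : commutative mxprod_add.
Proof. by move=> f g; apply/ffunP => j; rewrite !ffunE addrC. Qed.
Fact mxprod_add0 : left_id mxprod_zero mxprod_add.
Proof. by move=> f; apply/ffunP => j; rewrite !ffunE add0r. Qed.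
Fact mxprod_addN : left_inverse mxprod_zero mxprod_opp mxprod_add.
Proof. by move=> f; apply/ffunP => j; rewrite !ffunE addNr. Qed.
HB.instance Definition _ := GRing.isZmodule.Build mxprod
  mxprod_addA mxprod_addC mxprod_add0 mxprod_addN.

Fact mxprod_mulA : associative mxprod_mul.
Proof. by move=> f g h; apply/ffunP => j; rewrite !ffunE mulmxA. Qed.
Fact mxprod_mul1l : left_id mxprod_one mxprod_mul.
Proof. by move=> f; apply/ffunP => j; rewrite !ffunE mul1mx. Qed.
Fact mxprod_mul1r : right_id mxprod_one mxprod_mul.
Proof. by move=> f; apply/ffunP => j; rewrite !ffunE mulmx1. Qed.
Fact mxprod_mulDl : left_distributive mxprod_mul mxprod_add.
Proof. by move=> f g h; apply/ffunP => j; rewrite !ffunE mulmxDl. Qed.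
Fact mxprod_mulDr : right_distributive mxprod_mul mxprod_add.
Proof. by move=> f g h; apply/ffunP => j; rewrite !ffunE mulmxDr. Qed.
HB.instance Definition _ := GRing.Zmodule_isPzRing.Build mxprod
  mxprod_mulA mxprod_mul1l mxprod_mul1r mxprod_mulDl mxprod_mulDr.

Fact mxprod_scaleA c e f :
  mxprod_scale c (mxprod_scale e f) = mxprod_scale (c * e) f.
Proof.
by apply/ffunP => j; rewrite !ffunE scalerA -scalerAl mul1r scalerA.
Qed.
Fact mxprod_scale1 : left_id 1 mxprod_scale.
Proof. by move=> f; apply/ffunP => j; rewrite !ffunE !scale1r. Qed.
Fact mxprod_scaleDr : right_distributive mxprod_scale +%R.
Proof. by move=> c f g; apply/ffunP => j; rewrite !ffunE scalerDr. Qed.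
Fact mxprod_scaleDl f : {morph mxprod_scale^~ f : c e / c + e >-> c + e}.
Proof. by move=> c e; apply/ffunP => j; rewrite !ffunE !scalerDl. Qed.
HB.instance Definition _ := GRing.Zmodule_isLmodule.Build k mxprod
  mxprod_scaleA mxprod_scale1 mxprod_scaleDr mxprod_scaleDl.

End MatrixProduct.

Section Asymptotic.
Variables (k : comNzRingType) (A : algType k) (i : A -> A).
Variable C : affine_cellular i.

Definition ac_quot (j : 'I_(ac_len C)) : algType k := quot (ac_chain C j).
Definition ac_pi (j : 'I_(ac_len C)) (a : A) : ac_quot j := qpi (ac_chain C j) a.

Definition asymptotic : Type :=
  mxprod (fun j => cell_ring (ac_cell C j)) (fun j => cell_rank (ac_cell C j)).
HB.instance Definition _ := GRing.PzRing.on asymptotic.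
HB.instance Definition _ := GRing.Lmodule.on asymptotic.

Definition ac_one (j : 'I_(ac_len C)) : ac_quot j :=
  cell_alphaV (ac_cell C j) 1%:M.

(* The left action of [A] on a layer [chain j.+1 / chain j] of [A / chain j]. *)
Definition ac_lact (j : 'I_(ac_len C)) (a : A) (x : ac_quot j) : ac_quot j :=
  ac_pi j a * x.

Definition Theta (a : A) : asymptotic :=
  [ffun j => cell_alpha (ac_cell C j) (ac_lact a (ac_one j))].

End Asymptotic.

Arguments ac_quot {k A i} C j.
Arguments ac_pi {k A i} C j a.
Arguments ac_one {k A i} C j.
Arguments ac_lact {k A i} C j a x.
Arguments Theta {k A i} C a.

(* Main.v *)
Require Import Defs.
From HB Require Import structures.
From mathcomp Require Import all_boot all_order all_algebra generic_quotient.
From mathcomp Require Import boolp classical_sets.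

Set Implicit Arguments.
Unset Strict Implicit.
Unset Printing Implicit Defensive.

Import GRing.Theory.

Local Open Scope classical_set_scope.
Local Open Scope ring_scope.

(* On a cell ideal J, left multiplication by [a] is, through alpha, left
   multiplication by the matrix L(a) of the action of [a] on the cell module,
   and L is a representation. Applied to the identity matrix this says that
   Theta_j(a) = L_j(a mod J_(j-1)), so Theta is an algebra morphism; and
   alpha(xy) = alpha(x) psi alpha(y) gives L(x) = alpha(x) psi for x in J.
   As det psi is a nonzero-divisor, L is injective on each J_j / J_(j-1), so an
   element of the kernel of Theta descends through the chain down to J_0 = 0. *)

(** * Cancellation for matrices *)

Lemma mulmx_eq0_det (R : comNzRingType) (m n : nat) (M : 'M[R]_(m, n))
    (P : 'M[R]_n) : ~ zero_divisor (\det P) -> M *m P = 0 -> M = 0.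
Proof.
(* Multiplying [M *m P] by the adjugate of [P] replaces [P] by a scalar, so a nonzero entry of [M]
   would make [\det P] a zero-divisor. *)
move=> detP MP0; have : \det P *: M = 0.
  by rewrite -mul_mx_scalar -mul_mx_adj mulmxA MP0 mul0mx.
move=> /matrixP detM; apply/matrixP => r s; rewrite mxE.
apply/eqP/negPn/negP => /eqP Mrs; apply: detP; right.
by exists (M r s); split=> //; have := detM r s; rewrite !mxE.
Qed.

Lemma mulmx_delta_inj (R : pzRingType) (m n : nat) (P Q : 'M[R]_(m, n)) :
  (forall s, P *m delta_mx s (0 : 'I_1) = Q *m delta_mx s 0) -> P = Q.
Proof.
move=> PQ; apply/matrixP => r s.
by have /colP/(_ r) := PQ s; rewrite -!colE !mxE.
Qed.

(** * One cell ideal and the matrix representation on its cell module *)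

Section CellDatum.
Variables (k : comNzRingType) (A : algType k) (i : A -> A) (J : set A).
Variable D : cell_datum i J.

Local Notation B := (cell_ring D).
Local Notation d := (cell_rank D).
Local Notation alpha := (cell_alpha D).
Local Notation alphaV := (cell_alphaV D).

Definition act_mx (a : A) : 'M[B]_d :=
  \matrix_(r, s) cell_act D a (delta_mx s 0) r 0.

Lemma act_mxE (a : A) (x : 'cV[B]_d) : cell_act D a x = act_mx a *m x.
Proof.
rewrite {1}[x]matrix_sum_delta linear_sum /=; apply/colP => r.
rewrite summxE !mxE; apply: eq_bigr => s _.
by rewrite big_ord1 linearZ !mxE mulrC.
Qed.

Lemma act_mx1 : act_mx 1 = 1%:M.
Proof.
by apply: mulmx_delta_inj => s; rewrite -act_mxE cell_act1 mul1mx.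
Qed.

Lemma act_mxM (a b : A) : act_mx (a * b) = act_mx a *m act_mx b.
Proof.
by apply: mulmx_delta_inj => s; rewrite -act_mxE cell_actM !act_mxE mulmxA.
Qed.

Lemma act_mxD (a b : A) : act_mx (a + b) = act_mx a + act_mx b.
Proof.
by apply: mulmx_delta_inj => s; rewrite -act_mxE cell_actD !act_mxE mulmxDl.
Qed.

Lemma act_mxZ (c : k) (a : A) : act_mx (c *: a) = (c%:A : B) *: act_mx a.
Proof.
by apply: mulmx_delta_inj => s; rewrite -act_mxE cell_actZ act_mxE scalemxAl.
Qed.

Lemma act_mx0 : act_mx 0 = 0.
Proof. by apply: (addrI (act_mx 0)); rewrite -act_mxD !addr0. Qed.

Lemma alphaVD (M N : 'M[B]_d) : alphaV (M + N) = alphaV M + alphaV N.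
Proof.
have [J0 JB _ _] := cell_ideal D.
have JD x y : J x -> J y -> J (x + y).
  by move=> Jx Jy; rewrite -[y]opprK -[- y]sub0r; apply/JB/JB.
have JV (P : 'M[B]_d) : J (alphaV P) := cell_alphaV_in P.
rewrite -{1}[M]cell_alphaVK -{1}[N]cell_alphaVK -cell_alphaD //.
by rewrite cell_alphaK //; apply: JD.
Qed.

Lemma alphaV0 : alphaV 0 = 0.
Proof. by apply: (addrI (alphaV 0)); rewrite -alphaVD !addr0. Qed.

Lemma ideal_mulV (a : A) (M : 'M[B]_d) : J (a * alphaV M).
Proof. by have [_ _ + _] := cell_ideal D; apply; apply: cell_alphaV_in. Qed.

(** The bimodule axiom covers only pure tensors, that is, a column times a row. Both sides are
    additive in [M], and every matrix is the sum of its columns times unit rows. *)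
Lemma alpha_mulV (a : A) (M : 'M[B]_d) :
  alpha (a * alphaV M) = act_mx a *m M.
Proof.
pose P M := alpha (a * alphaV M) = act_mx a *m M.
have P1 (x : 'cV[B]_d) (y : 'rV[B]_d) : P (x *m y).
  by rewrite /P cell_alpha_left act_mxE mulmxA.
have PD N N' : P N -> P N' -> P (N + N').
  rewrite /P alphaVD mulrDr cell_alphaD; try exact: ideal_mulV.
  by move=> -> ->; rewrite mulmxDr.
suff -> : M = \sum_s col s M *m delta_mx 0 s.
  apply: (big_ind P) => [||s _]; [|exact: PD | exact: P1].
  by have := P1 0 0; rewrite mulmx0.
rewrite -{1}[M]mulmx1; apply/matrixP => r t; rewrite mxE summxE.
apply: eq_bigr => s _; rewrite !mxE big_ord1 !mxE.
by congr (_ * _%:R); rewrite eq_sym.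
Qed.

Lemma tensor3_delta (r s : 'I_d) (b : B) :
  tensor3 (delta_mx r 0) b (delta_mx s 0) = b *: delta_mx r s.
Proof.
apply/matrixP => p q; rewrite !mxE !eqxx !andbT.
by case: (p == r); case: (q == s);
  rewrite ?(mul0r, mul1r, mulr0, mulr1, scale0r, scale1r).
Qed.

(** By additivity, [M] may be taken to be [b *: delta_mx r s]. The product of two basis tensors is
    then computed twice, through the left action and through [cell_psi]. *)
Lemma act_mx_alphaV (M : 'M[B]_d) : act_mx (alphaV M) = M *m swich D.
Proof.
pose P M := act_mx (alphaV M) = M *m swich D.
suff Pdelta r s b : P (b *: delta_mx r s).
  rewrite -/(P M) [M]matrix_sum_delta.
  have P0 : P 0 by rewrite /P alphaV0 act_mx0 mul0mx.
  have PD N N' : P N -> P N' -> P (N + N').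
    by rewrite /P alphaVD act_mxD mulmxDl => -> ->.
  by do 2!apply: (big_ind P) => // ? _.
rewrite /P; apply: mulmx_delta_inj => q.
(* The second factor corresponds to [delta_mx q q], which isolates column [q] of the action
   matrix. *)
have /(congr1 (col q)) := @cell_psiE _ _ _ _ D (delta_mx r 0) b (delta_mx s 0)
  (delta_mx q 0) 1 (delta_mx q 0).
rewrite alpha_mulV !tensor3_delta scale1r mulr1 !colE -!mulmxA.
rewrite mul_delta_mx => ->.
apply/matrixP => p t; rewrite -!scalemxAl mul_delta_mx !mxE.
rewrite (bigD1 s) //= big1 => [|l /negPf sl]; last first.
  by rewrite !mxE sl andbF mul0r.
rewrite addr0 -colE !mxE eqxx andbT (ord1 t) eqxx andbT.
by rewrite -mulrA [cell_psi _ _ _ * _]mulrC.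
Qed.

Lemma act_mx_ideal (x : A) : J x -> act_mx x = alpha x *m swich D.
Proof. by move=> Jx; rewrite -act_mx_alphaV cell_alphaK. Qed.

Lemma act_mx_ideal_eq0 (x : A) : ~ zero_divisor (\det (swich D)) ->
  J x -> act_mx x = 0 -> x = 0.
Proof.
move=> detD Jx; rewrite act_mx_ideal // => /(mulmx_eq0_det detD) ax0.
by rewrite -[x](cell_alphaK D Jx) ax0 alphaV0.
Qed.

End CellDatum.

(** * From the layers to the whole algebra *)

Section Cellular.
Variables (k : comNzRingType) (A : algType k) (i : A -> A).
Variable C : affine_cellular i.

Lemma ac_piD j (a b : A) : ac_pi C j (a + b) = ac_pi C j a + ac_pi C j b.
Proof. by rewrite [RHS]/GRing.add /= qaddE. Qed.

Lemma ac_piM j (a b : A) : ac_pi C j (a * b) = ac_pi C j a * ac_pi C j b.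
Proof. by rewrite [RHS]/GRing.mul /= qmulE. Qed.

Lemma ac_piZ j (c : k) (a : A) : ac_pi C j (c *: a) = c *: ac_pi C j a.
Proof. by rewrite [RHS]/GRing.scale /= qscaleE. Qed.

Lemma ac_pi_eq0 j (a : A) : ac_pi C j a = 0 <-> chain (ac_layer C) j a.
Proof. by rewrite -[a in X in _ <-> X]subr0; apply: qpiE. Qed.

Lemma layer_chain (l : 'I_(ac_len C)) (m : nat) (a : A) :
  (l < m)%N -> ac_layer C l a -> chain (ac_layer C) m a.
Proof.
move=> lm la; exists (fun j => if j == l then a else 0); split=> [j|].
  by case: eqP => [->|_] //; apply: ac_layer0.
by rewrite (bigD1 l) //= eqxx big1 ?addr0 // => j /andP[_ /negPf ->].
Qed.

Lemma chain_full (a : A) : chain (ac_layer C) (ac_len C) a.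
Proof.
have [f [lf ->]] := ac_layer_span C a; exists f; split=> //.
by apply: eq_bigl => l; rewrite ltn_ord.
Qed.

Lemma chain0 (a : A) : chain (ac_layer C) 0 a -> a = 0.
Proof. by move=> [f [_ ->]]; rewrite big_pred0. Qed.

Lemma Theta_act_mx (a : A) j :
  Theta C a j = act_mx (ac_cell C j) (ac_pi C j a).
Proof. by rewrite ffunE /ac_lact alpha_mulV mulmx1. Qed.

Lemma Theta_linear : linear (Theta C : A -> asymptotic C).
Proof.
move=> c a b; apply/ffunP => j.
have -> : (c *: Theta C a + Theta C b) j =
    (c%:A : cell_ring (ac_cell C j)) *: Theta C a j + Theta C b j.
  by rewrite ffunE [X in X + _]ffunE.
by rewrite !Theta_act_mx ac_piD ac_piZ act_mxD act_mxZ.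
Qed.

Lemma Theta_monoid_morphism : monoid_morphism (Theta C : A -> asymptotic C).
Proof.
split=> [|a b]; apply/ffunP => j; rewrite Theta_act_mx.
  by rewrite ffunE -act_mx1.
by rewrite ffunE !Theta_act_mx ac_piM act_mxM.
Qed.

Lemma Theta_layer (m : 'I_(ac_len C)) (a : A) : ac_layer C m a ->
  Theta C a m =
    cell_alpha (ac_cell C m) (ac_pi C m a) *m swich (ac_cell C m).
Proof.
move=> ma; rewrite Theta_act_mx act_mx_ideal //; exists a => //.
exact: layer_chain ma.
Qed.

(** Component [l] factors through the quotient by [chain l]. Since layer [m] lies in [chain l] for
    [m < l], an element of a layer has zero components above the index of that layer. *)
Lemma Theta_chain (l : 'I_(ac_len C)) (a : A) :
  chain (ac_layer C) l a -> Theta C a l = 0.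
Proof. by move=> /ac_pi_eq0 pa0; rewrite Theta_act_mx pa0 act_mx0. Qed.

Hypothesis det_swich : forall j : 'I_(ac_len C),
  ~ zero_divisor (\det (swich (ac_cell C j))).

Lemma Theta_eq0 (a : A) : (forall j, Theta C a j = 0) -> a = 0.
Proof.
move=> Ta0; apply: chain0.
(* Here [m] counts the steps down from the top of the chain. *)
suff: forall m, (m <= ac_len C)%N -> chain (ac_layer C) (ac_len C - m) a.
  by move=> /(_ _ (leqnn _)); rewrite subnn.
elim=> [_|m IHm lt_m]; first by rewrite subn0; apply: chain_full.
have lt_len : (ac_len C - m.+1 < ac_len C)%N.
  by rewrite ltn_subrL (leq_trans _ lt_m).
pose j := Ordinal lt_len.
apply: (proj1 (ac_pi_eq0 j a)).
(* As [j.+1] is [ac_len C - m], the induction hypothesis places the class of [a] in the cell ideal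
   of index [j], where the action is faithful. *)
apply: (act_mx_ideal_eq0 (det_swich (j := j))); last by rewrite -Theta_act_mx.
by exists a => //=; rewrite subnSK //; apply/IHm/ltnW.
Qed.

Lemma Theta_inj : injective (Theta C).
Proof.
move=> a b Tab; apply/subr0_eq/Theta_eq0 => j.
(* [a - b] is rewritten as [-1 *: b + a] to match the form of [Theta_linear]. *)
by rewrite addrC -scaleN1r Theta_linear Tab scaleN1r addNr ffunE.
Qed.

End Cellular.

Theorem theoremA (k : idomainType) (k_noetherian : noetherian k)
    (A : algType k) (i : A -> A) (i_involution : k_involution i)
    (C : affine_cellular i)
    (det_swich : forall j : 'I_(ac_len C),
       ~ zero_divisor (\det (swich (ac_cell C j)))) :
  [/\ (* [Theta] is an embedding of [k]-algebras *)
      [/\ linear (Theta C : A -> asymptotic C),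
          monoid_morphism (Theta C : A -> asymptotic C)
        & injective (Theta C)],
      forall (a : A) (j : 'I_(ac_len C)),
        Theta C a j = cell_alpha (ac_cell C j) (ac_lact C j a (ac_one C j))
    & forall (m : 'I_(ac_len C)) (a : A), ac_layer C m a ->
        [/\ Theta C a m =
              cell_alpha (ac_cell C m) (ac_pi C m a) *m swich (ac_cell C m),
            (forall l : 'I_(ac_len C), (l < m)%N ->
               Theta C a l =
                 cell_alpha (ac_cell C l) (ac_lact C l a (ac_one C l)))
          & (forall l : 'I_(ac_len C), (m < l)%N -> Theta C a l = 0)]].
Proof.
split=> [|a j|m a ma]; last split=> [|l _|l ml].
- split; [exact: Theta_linear | exact: Theta_monoid_morphism | exact: Theta_inj].
- by rewrite ffunE.
- exact: Theta_layer.
- by rewrite ffunE.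
- exact/Theta_chain/(layer_chain ml).
Qed.
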